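(* Let $G$ be a topological group and let $\phi: G \rightarrow H$ be a t.d.l.c. completion map. Let $U\leq G$ be the preimage under $\phi$ of some compact open subgroup of $H$. Then there are unique continuous quotient maps $\psi_1: \hat{G}_U \rightarrow H$ and $\psi_2: H \rightarrow G/\!\!/U$ with compact kernels such that $\psi_1\circ\beta_U=\phi$ and $\psi_2\circ\phi=\beta_{G/U}$.
   Context: Topological groups are Hausdorff. A t.d.l.c. group is a totally disconnected, locally compact (Hausdorff) topological group. A (t.d.l.c.) completion map is a continuous homomorphism $\phi:G\rightarrow H$ with dense image such that $H$ is a t.d.l.c. group. A quotient map is a surjective continuous open homomorphism. Two subgroups $U,V$ of a group are commensurate if $U\cap V$ has finite index in both. A subgroup $W$ of $G$ is commensurated in $G$ if $W$ is commensurate with $gWg^{-1}$ for all $g\in G$. For a subgroup $U$ of $G$, $[U]$ is the set of closed subgroups of $G$ commensurate with $U$. (If $U$ is the preimage of a compact open subgroup under a completion map, then $U$ is open and commensurated in $G$.) A $G$-stable local filter is a set $\mathcal{S}$ of open subgroups of $G$ such that: (a) $\mathcal{S}$ is non-empty; (b) any two elements of $\mathcal{S}$ are commensurate; (c) finite intersections of elements of $\mathcal{S}$ lie in $\mathcal{S}$, and given $V\le W\le G$ with $|W:V|$ finite, $V\in\mathcal{S}$ implies $W\in\mathcal{S}$; (d) if $V\in\mathcal{S}$ and $g\in G$ then $gVg^{-1}\in\mathcal{S}$. Completion with respect to $\mathcal{S}$. A (right) $\mathcal{S}$-Cauchy filter in $G$ is a filter $f$ of subsets of $G$ such that for every $V\in\mathcal{S}$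 there is exactly one right coset $Vg$ of $V$ with $Vg\in f$, and every element of $f$ contains a right coset of some element of $\mathcal{S}$. The set $\hat{G}_{\mathcal{S}}$ consists of all $\mathcal{S}$-Cauchy filters in $G$, with the topology of the uniformity whose entourages are $E_W=\{(f,f')\mid \exists g\in G: Wg\in f\cap f'\}$ for $W\in\mathcal{S}$. For $f,f'\in\hat{G}_{\mathcal{S}}$, the product $ff'$ is the $\mathcal{S}$-Cauchy filter generated by the sets $AB$ with $A\in f$, $B\in f'$; with this multiplication $\hat{G}_{\mathcal{S}}$ is a topological group. The map $\beta_{(G,\mathcal{S})}:G\rightarrow\hat{G}_{\mathcal{S}}$ sends $g$ to the filter generated by $\{Vg\mid V\in\mathcal{S}\}$; it is a continuous homomorphism with dense image. For an open commensurated subgroup $U$ of $G$, both $[U]$ and $\mathcal{S}_{G/U}:=\{V\in[U]\mid \exists g_1,\dots,g_n\in G \text{ with } \bigcap_{i=1}^n g_iUg_i^{-1}\le V\}$ are $G$-stable local filters. The Belyaev completion is $\hat{G}_U:=\hat{G}_{[U]}$ with map $\beta_U:=\beta_{(G,[U])}$. The Schlichting completion is $G/\!\!/U:=\hat{G}_{\mathcal{S}_{G/U}}$ with map $\beta_{G/U}:=\beta_{(G,\mathcal{S}_{G/U})}$.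
   Formalization: In the definition of an S-Cauchy filter f, every element of f is required to contain a right coset of some element of S that itself belongs to f; with an arbitrary coset the completion would be neither Hausdorff nor a group (e.g. for the p-adic integers). *)

(* Defs.v *)
From HB Require Import structures.
From mathcomp Require Import all_boot all_classical.
From mathcomp Require Import topology.

Set Implicit Arguments.
Unset Strict Implicit.
Unset Printing Implicit Defensive.

Local Open Scope classical_set_scope.
Local Open Scope group_scope.

HB.mixin Record isTopGroup G of Topological G & Group G := {
  mulg_continuous : continuous (fun x : G * G => x.1 * x.2);
  invg_continuous : continuous (fun x : G => x^-1);
  topgroup_hausdorff : hausdorff_space G
}.

#[short(type="topGroupType")]
HB.structure Definition TopGroup :=
  {G of Topological G & Group G & isTopGroup G}.

Section Subgroups.
Variable G : groupType.
Implicit Types (U V W : set G) (g : G).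

Record is_subgroup V : Prop := IsSubgroup {
  subgroup1 : V 1;
  subgroupM : forall x y, V x -> V y -> V (x * y);
  subgroupV : forall x, V x -> V x^-1
}.

Definition rcoset V g : set G := [set v * g | v in V].

(* g V g^-1; note that mathcomp's x ^ g is g^-1 * x * g. *)
Definition conjs g V : set G := [set g * v * g^-1 | v in V].

(* For subgroups V <= W: the index |W : V| is finite. *)
Definition finite_index V W := finite_set [set rcoset V w | w in W].

Definition commensurate U V :=
  finite_index (U `&` V) U /\ finite_index (U `&` V) V.

Definition commensurated W := forall g, commensurate W (conjs g W).

Lemma rcosetE V g x : rcoset V g x = V (x * g^-1).
Proof.
apply/propext; split=> [[v Vv <-]|Vx]; first by rewrite mulgK.
by exists (x * g^-1) => //; rewrite mulgVK.
Qed.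

Lemma conjsE V g x : conjs g V x = V (g^-1 * x * g).
Proof.
apply/propext; split=> [[v Vv <-]|Vx]; first by rewrite !mulgA mulVg mul1g mulgVK.
by exists (g^-1 * x * g) => //; rewrite !mulgA mulgV mul1g mulgK.
Qed.

Lemma rcoset_id V g : is_subgroup V -> rcoset V g g.
Proof. by move=> sV; rewrite rcosetE mulgV; apply: subgroup1. Qed.

Lemma rcoset1 V : rcoset V 1 = V.
Proof. by apply/funext => x; rewrite rcosetE invg1 mulg1. Qed.

Lemma rcoset_eq V g x : is_subgroup V -> rcoset V g x -> rcoset V g = rcoset V x.
Proof.
move=> sV; rewrite rcosetE => Vx; apply/seteqP; split=> y; rewrite !rcosetE => Vy.
  by rewrite -(mulgVK g y) -mulgA -[g * _]invgK invgM invgK;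
    apply: subgroupM Vy _ => //; apply: subgroupV.
by rewrite -(mulgVK x y) -mulgA; apply: subgroupM.
Qed.

Lemma subgroupI V W : is_subgroup V -> is_subgroup W -> is_subgroup (V `&` W).
Proof.
move=> sV sW; split; first by split; apply: subgroup1.
- by move=> x y [? ?] [? ?]; split; apply: subgroupM.
- by move=> x [? ?]; split; apply: subgroupV.
Qed.

Lemma subgroup_conjs g V : is_subgroup V -> is_subgroup (conjs g V).
Proof.
move=> sV; split; first by rewrite conjsE mulg1 mulVg; apply: subgroup1.
- move=> x y; rewrite !conjsE => Vx Vy.
  have := subgroupM sV Vx Vy.
  by rewrite !mulgA mulgK.
- by move=> x; rewrite !conjsE => /(subgroupV sV); rewrite !invgM invgK mulgA.
Qed.

Lemma conjsM g h V : conjs g (conjs h V) = conjs (g * h) V.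
Proof. by apply/funext => x; rewrite !conjsE invgM !mulgA. Qed.

Lemma conjs1 V : conjs 1 V = V.
Proof. by apply/funext => x; rewrite !conjsE invg1 mul1g mulg1. Qed.

Lemma conjsI g V W : conjs g (V `&` W) = conjs g V `&` conjs g W.
Proof. by apply/seteqP; split=> x; rewrite /setI /= !conjsE. Qed.

Lemma finite_index_conjs g V W : finite_index V W ->
  finite_index (conjs g V) (conjs g W).
Proof.
move=> fi; apply: (sub_finite_set _ (finite_image (conjs g) fi)).
move=> _ [w Ww <-]; rewrite conjsE in Ww; exists (rcoset V (g^-1 * w * g)); first by exists (g^-1 * w * g).
by apply/funext => x; rewrite rcosetE !conjsE rcosetE !invgM invgK !mulgA mulgK.
Qed.

Lemma finite_indexP V W : is_subgroup V ->
  (exists s : seq G, forall w, W w -> exists2 t, t \in s & V (w * t^-1)) ->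
  finite_index V W.
Proof.
move=> sV [s sP].
apply: (sub_finite_set _ (finite_image (rcoset V) (finite_seq s))).
move=> _ [w Ww <-]; have [t ts Vt] := sP w Ww; exists t => //.
by apply: rcoset_eq => //; rewrite rcosetE.
Qed.

Lemma finite_index_seq V W : is_subgroup V -> finite_index V W ->
  exists s : seq G, forall w, W w -> exists2 t, t \in s & V (w * t^-1).
Proof.
move=> sV fi.
pose r (C : set G) := xget 1 C.
have /finite_seqP[s sE] := finite_image r fi.
exists s => w Ww; exists (r (rcoset V w)).
  have : [set r x | x in [set rcoset V w | w in W]] (r (rcoset V w)).
    by exists (rcoset V w) => //; exists w.
  by rewrite sE.
have : rcoset V w (r (rcoset V w)).
  by rewrite /r; case: xgetP => // /(_ w) []; apply: rcoset_id.
by rewrite rcosetE => /(subgroupV sV); rewrite invgM invgK.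
Qed.

Lemma finite_index_trans U V W : is_subgroup U -> is_subgroup V ->
  finite_index U V -> finite_index V W -> finite_index U W.
Proof.
move=> sU sV /(finite_index_seq sU)[s sP] /(finite_index_seq sV)[t tP].
apply: finite_indexP => //; exists [seq a * b | a <- s, b <- t] => w Ww.
have [b bt /sP[a as_ Ua]] := tP w Ww; exists (a * b).
  by apply/allpairsP; exists (a, b).
by rewrite invgM mulgA.
Qed.

Lemma finite_index_setI U V W : is_subgroup W ->
  finite_index U V -> finite_index (U `&` W) (V `&` W).
Proof.
move=> sW fi; apply: (sub_finite_set _ (finite_image (fun C => C `&` W) fi)).
move=> _ [w [Vw Ww] <-]; exists (rcoset U w); first by exists w.
apply/seteqP; split=> x; rewrite /setI /= !rcosetE /=.
  by move=> [Ux Wx]; split=> //; apply: subgroupM => //; apply: subgroupV.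
move=> [Ux Wx]; split=> //; rewrite -(mulgVK w x); exact: subgroupM.
Qed.

Lemma finite_index_subl U V W : is_subgroup U -> is_subgroup V ->
  U `<=` V -> finite_index U W -> finite_index V W.
Proof.
move=> sU sV UV /(finite_index_seq sU)[s sP]; apply: finite_indexP => //.
by exists s => w /sP[t ts /UV ?]; exists t.
Qed.

Lemma finite_index_refl V : is_subgroup V -> finite_index V V.
Proof.
move=> sV; apply: finite_indexP => //; exists [:: 1] => w Vw.
by exists 1; rewrite ?mem_head// invg1 mulg1.
Qed.

Lemma commensurate_sym U V : commensurate U V -> commensurate V U.
Proof. by rewrite /commensurate setIC => -[]. Qed.

Lemma commensurate_half U V W : is_subgroup U -> is_subgroup V ->
  is_subgroup W -> finite_index (U `&` V) U -> finite_index (V `&` W) V ->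
  finite_index (U `&` W) U.
Proof.
move=> sU sV sW UV VW; have sUV := subgroupI sU sV.
have sVW := subgroupI sV sW.
apply: (@finite_index_subl (V `&` W `&` U)).
- exact: subgroupI.
- exact: subgroupI.
- by move=> x [[? ?] ?].
apply: (@finite_index_trans _ (U `&` V)) => //; first exact: subgroupI.
by rewrite [U `&` V]setIC; apply: finite_index_setI.
Qed.

Lemma commensurate_trans U V W : is_subgroup U -> is_subgroup V ->
  is_subgroup W -> commensurate U V -> commensurate V W -> commensurate U W.
Proof.
move=> sU sV sW [UV VU] [VW WV]; split; first exact: (commensurate_half sU sV).
rewrite setIC; apply: (commensurate_half sW sV sU); by rewrite setIC.
Qed.

Lemma commensurate_refl U : is_subgroup U -> commensurate U U.
Proof. by move=> sU; split; rewrite setIid; apply: finite_index_refl. Qed.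

Lemma commensurate_conjs g U V : commensurate U V ->
  commensurate (conjs g U) (conjs g V).
Proof.
by move=> [UV VU]; split; rewrite -conjsI; apply: finite_index_conjs.
Qed.

Lemma commensurate_super U V : is_subgroup U -> U `<=` V ->
  finite_index U V -> commensurate U V.
Proof.
move=> sU /setIidPl UV fi; split; rewrite UV //; exact: finite_index_refl.
Qed.

Lemma commensurate_setI U V W : is_subgroup U -> is_subgroup V ->
  is_subgroup W -> commensurate U V -> commensurate U W ->
  commensurate U (V `&` W).
Proof.
move=> sU sV sW [UV VU] [UW WU]; have sUV := subgroupI sU sV; split.
  rewrite setIA; apply: (@finite_index_trans _ (U `&` V)) => //.
  - exact: subgroupI.
  - by rewrite setIAC; apply: finite_index_setI.
rewrite setIA; exact: finite_index_setI.
Qed.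

End Subgroups.

Section TopGroupTheory.
Variable G : topGroupType.
Implicit Types (U V W : set G) (g : G).

Lemma mulgl_continuous g : continuous (fun x : G => g * x).
Proof.
move=> x; have := @mulg_continuous G (g, x).
apply: (@continuous_comp _ _ _ (fun y => (g, y)) (fun x : G * G => x.1 * x.2)).
by apply: cvg_pair => /=; [exact: cvg_cst | exact: cvg_id].
Qed.

Lemma mulgr_continuous g : continuous (fun x : G => x * g).
Proof.
move=> x; have := @mulg_continuous G (x, g).
apply: (@continuous_comp _ _ _ (fun y => (y, g)) (fun x : G * G => x.1 * x.2)).
by apply: cvg_pair => /=; [exact: cvg_id | exact: cvg_cst].
Qed.

Lemma rcoset_preim V g : rcoset V g = (fun x => x * g^-1) @^-1` V.
Proof. by apply/funext => x; rewrite rcosetE. Qed.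

Lemma open_rcoset V g : open V -> open (rcoset V g).
Proof.
move=> oV; rewrite rcoset_preim; apply: open_comp => // x _.
exact: mulgr_continuous.
Qed.

Lemma closed_rcoset V g : closed V -> closed (rcoset V g).
Proof.
move=> cV; rewrite rcoset_preim; move: cV.
by apply: (continuous_closedP _).1 => x; exact: mulgr_continuous.
Qed.

Lemma conjs_preim V g : conjs g V = (fun x => g^-1 * x) @^-1` ((fun x => x * g) @^-1` V).
Proof. by apply/funext => x; rewrite conjsE. Qed.

Lemma open_conjs V g : open V -> open (conjs g V).
Proof.
move=> oV; rewrite conjs_preim; apply: open_comp.
  by move=> x _; exact: mulgl_continuous.
by apply: open_comp => // x _; exact: mulgr_continuous.
Qed.

Lemma closed_conjs V g : closed V -> closed (conjs g V).
Proof.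
move=> cV; rewrite conjs_preim.
apply: (continuous_closedP _).1; first by move=> x; exact: mulgl_continuous.
by apply: (continuous_closedP _).1 => // x; exact: mulgr_continuous.
Qed.

Lemma open_superset V W : is_subgroup W -> V `<=` W -> V 1 -> open V -> open W.
Proof.
move=> sW VW V1 oV.
have -> : W = \bigcup_(w in W) rcoset V w.
  apply/seteqP; split=> x.
    by move=> Wx; exists x => //; rewrite rcosetE mulgV.
  move=> [w Ww]; rewrite rcosetE => /VW Wxw.
  by rewrite -(mulgVK w x); apply: subgroupM.
by apply: bigcup_open => w _; apply: open_rcoset.
Qed.

Lemma open_subgroup_closed V : is_subgroup V -> open V -> closed V.
Proof.
move=> sV oV; rewrite -[V]setCK; apply: open_closedC.
have -> : ~` V = \bigcup_(w in ~` V) rcoset V w.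
  apply/seteqP; split=> x; first by move=> Vx; exists x => //; apply: rcoset_id.
  move=> [w nVw]; rewrite rcosetE => Vxw Vx; apply: nVw.
  have := subgroupM sV (subgroupV sV Vxw) Vx.
  by rewrite invgM invgK mulgVK.
by apply: bigcup_open => w _; apply: open_rcoset.
Qed.

Lemma closed_finite_index_open V W : is_subgroup V -> closed V ->
  open W -> V `<=` W -> finite_index V W -> open V.
Proof.
move=> sV cV oW VW fi.
pose D := [set rcoset V w | w in W `\` V].
have fD : finite_set D by apply: sub_finite_set fi; apply: image_subset => x [].
have cD : closed (\bigcup_(C in D) C).
  by apply: closed_bigcup => // _ [w _ <-]; apply: closed_rcoset.
have -> : V = W `&` ~` (\bigcup_(C in D) C).
  apply/seteqP; split=> x.
    move=> Vx; split; first exact: VW.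
    move=> [_ [w [_ nVw] <-]]; rewrite rcosetE => Vxw; apply: nVw.
    have := subgroupM sV (subgroupV sV Vxw) Vx.
    by rewrite invgM invgK mulgVK.
  move=> [Wx nD]; apply: contrapT => nVx; apply: nD.
  by exists (rcoset V x); [exists x | apply: rcoset_id].
by apply: openI => //; apply: closed_openC.
Qed.

End TopGroupTheory.

Record is_local_filter (G : topGroupType) (S : set (set G)) : Prop := IsLocalFilter {
  locfilt_open : forall V, S V -> is_subgroup V /\ open V;
  locfilt_neq0 : S !=set0;
  locfilt_comm : forall V W, S V -> S W -> commensurate V W;
  locfilt_setI : forall V W, S V -> S W -> S (V `&` W);
  locfilt_super : forall V W, is_subgroup W -> V `<=` W -> finite_index V W ->
    S V -> S W;
  locfilt_conjs : forall V g, S V -> S (conjs g V)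
}.

Record local_filter (G : topGroupType) := LocalFilter {
  locfilt_set :> set G -> Prop;
  locfilt_is_local_filter : is_local_filter locfilt_set
}.

Section Completion.
Variables (G : topGroupType) (S : local_filter G).

(* In the last field the coset is required to belong to f, that is, f is the
   filter generated by the right cosets it contains.  This makes f the minimal
   Cauchy filter of its class; if the coset could be any right coset, the
   completion would in general be neither Hausdorff nor a group. *)
Record is_cauchy (f : set_system G) : Prop := IsCauchy {
  cauchy_filter : Filter f;
  cauchy_coset : forall V, S V -> exists! C, range (rcoset V) C /\ f C;
  cauchy_base : forall A, f A ->
    exists V g, [/\ S V, f (rcoset V g) & rcoset V g `<=` A]
}.

Record completion := Completion {
  cauchy_sets :> set G -> Prop;
  cauchy_is_cauchy : is_cauchy cauchy_sets
}.

HB.instance Definition _ := gen_eqMixin completion.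
HB.instance Definition _ := gen_choiceMixin completion.

Implicit Types (f : completion) (V W : set G) (g h : G).

Let Ssub V : S V -> is_subgroup V.
Proof. by case: S => ? [] /= H _ _ _ _ _ /H []. Qed.
Let SI V W : S V -> S W -> S (V `&` W).
Proof. by case: S => ? [] /= _ _ _ H _ _; apply: H. Qed.
Let SJ V g : S V -> S (conjs g V).
Proof. by case: S => ? [] /= _ _ _ _ _ H; apply: H. Qed.
Let Scomm V W : S V -> S W -> commensurate V W.
Proof. by case: S => ? [] /= _ _ H _ _ _; apply: H. Qed.
Let S0 : locfilt_set S !=set0.
Proof. by case: S => ? []. Qed.

Let cF f : Filter (cauchy_sets f). Proof. by case: f => ? []. Qed.

Lemma cauchy_ex f V : S V -> exists g, f (rcoset V g).
Proof.
by case: f => f [/= ? cs _] /cs [_ [[[g _ <-] fg] _]]; exists g.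
Qed.

Lemma cauchy_uniq f V g h : S V -> f (rcoset V g) -> f (rcoset V h) ->
  rcoset V g = rcoset V h.
Proof.
case: f => f [/= ? cs _] /cs [C [_ CP]] fg fh.
by rewrite -(CP (rcoset V g)); [apply: CP; split=> //; exists h | split=> //; exists g].
Qed.

Lemma cauchy_neq0 f A : f A -> A !=set0.
Proof.
case: f => f [/= ? _ cb] /cb [V [g [SV _ VA]]].
by exists g; apply: VA; apply: rcoset_id; apply: Ssub.
Qed.

Lemma cauchy_subP f A : f A ->
  exists V g, [/\ S V, f (rcoset V g) & rcoset V g `<=` A].
Proof. by case: f => f [/= _ _ cb] /cb. Qed.

Lemma cauchy_ext f f' :
  (forall V g, S V -> f (rcoset V g) -> f' (rcoset V g)) -> f = f'.
Proof.
move=> ff'.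
have E : cauchy_sets f = cauchy_sets f'.
  apply/seteqP; split=> A.
    move=> /cauchy_subP [V [g [SV fV VA]]].
    by apply: (@filterS _ _ (cF f') _ _ VA); apply: ff'.
  move=> /cauchy_subP [V [g [SV fV VA]]].
  have [h fh] := cauchy_ex f SV.
  have := cauchy_uniq SV (ff' _ _ SV fh) fV => E.
  by apply: (@filterS _ _ (cF f) _ _ VA); rewrite -E.
case: f f' E {ff'} => f fP [f' f'P] /= E; subst f'.
by congr Completion; apply: Prop_irrelevance.
Qed.

Lemma is_cauchyI (f : set_system G) : Filter f ->
  (forall A, f A -> A !=set0) ->
  (forall V, S V -> exists g, f (rcoset V g)) ->
  (forall A, f A ->
    exists V g, [/\ S V, f (rcoset V g) & rcoset V g `<=` A]) ->
  is_cauchy f.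
Proof.
move=> Ff f0 fex fb; split=> // V SV.
have [g fg] := fex _ SV; exists (rcoset V g); split; first by split; [exists g|].
move=> _ [[h _ <-] fh].
have /f0 [x [xg xh]] : f (rcoset V g `&` rcoset V h) by apply: filterI.
by rewrite (rcoset_eq (Ssub SV) xg) (rcoset_eq (Ssub SV) xh).
Qed.

Definition principal_sets g : set_system G :=
  [set A | exists2 V, S V & rcoset V g `<=` A].

Lemma principal_is_cauchy g : is_cauchy (principal_sets g).
Proof.
apply: is_cauchyI.
- split.
  + by have [V SV] := S0; exists V.
  + move=> A B [V SV VA] [W SW WB]; exists (V `&` W); first exact: SI.
    by move=> x; rewrite rcosetE => -[Vx Wx]; split;
      [apply: VA|apply: WB]; rewrite rcosetE.
  + by move=> A B AB [V SV VA]; exists V => // x /VA /AB.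
- by move=> A [V /Ssub SV VA]; exists g; apply/VA/rcoset_id.
- by move=> V SV; exists g; exists V.
- by move=> A [V SV VA]; exists V, g; split=> //; exists V.
Qed.

Definition completion_map g : completion := Completion (principal_is_cauchy g).

Definition prod_sets (f f' : set_system G) : set_system G :=
  [set C | exists A B,
    [/\ f A, f' B & [set a * b | a in A & b in B] `<=` C]].

Lemma rcosetMP V g h x y : is_subgroup V ->
  rcoset V g x -> rcoset (conjs g^-1 V) h y -> rcoset V (g * h) (x * y).
Proof.
move=> sV; rewrite !rcosetE conjsE !invgK invgM => Vx Vy.
have := subgroupM sV Vx Vy.
by rewrite !mulgA mulgVK.
Qed.

Lemma prod_is_cauchy f f' : is_cauchy (prod_sets (cauchy_sets f) (cauchy_sets f')).
Proof.
apply: is_cauchyI.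
- split.
  + by exists setT, setT; split=> //; exact: (@filterT _ _ (cF _)).
  + move=> C C' [A [B [fA fB ABC]]] [A' [B' [fA' fB' ABC']]].
    exists (A `&` A'), (B `&` B'); split.
    * exact: (@filterI _ _ (cF f)).
    * exact: (@filterI _ _ (cF f')).
    * move=> _ [a [Aa A'a] [b [Bb B'b] <-]].
      by split; [apply: ABC|apply: ABC']; exists a => //; exists b.
  + move=> C D CD [A [B [fA fB ABC]]]; exists A, B; split=> // x /ABC; exact: CD.
- move=> C [A [B [/cauchy_neq0 [a Aa] /cauchy_neq0 [b Bb] ABC]]].
  by exists (a * b); apply: ABC; exists a => //; exists b.
- move=> V SV; have [g fg] := cauchy_ex f SV.
  have [h fh] := cauchy_ex f' (SJ g^-1 SV).
  exists (g * h), (rcoset V g), (rcoset (conjs g^-1 V) h); split=> //.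
  by move=> _ [a Va [b Vb <-]]; apply: rcosetMP => //; apply: Ssub.
- move=> C [A [B [/cauchy_subP [V [g [SV fg VA]]]]]].
  move=> /cauchy_subP [W [h [SW fh WB]]] ABC.
  have [k fk] := cauchy_ex f' (SJ g^-1 SV).
  exists V, (g * k).
  have E : rcoset V (g * k) `<=` C.
    have [y [yh yk]] : rcoset W h `&` rcoset (conjs g^-1 V) k !=set0.
      by apply: (@cauchy_neq0 f'); apply: (@filterI _ _ (cF f')).
    have := rcosetMP (Ssub SV) (rcoset_id g (Ssub SV)) yk.
    move=> /(rcoset_eq (Ssub SV)) -> z zV; apply: ABC.
    exists (z * y^-1); last by exists y; rewrite ?mulgVK //; apply: WB.
    apply: VA; move: zV; rewrite !rcosetE invgM !mulgA //.
  split=> //; exists (rcoset V g), (rcoset (conjs g^-1 V) k); split=> //.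
  by move=> _ [a Va [b Vb <-]]; apply: rcosetMP => //; apply: Ssub.
Qed.

Definition completion_mul f f' : completion := Completion (prod_is_cauchy f f').

Definition inv_sets (f : set_system G) : set_system G :=
  [set A | f ((fun x => x^-1) @^-1` A)].

Lemma finite_setI_filt (s : seq (set G)) : (forall V, V \in s -> S V) ->
  exists2 W, S W & forall V, V \in s -> W `<=` V.
Proof.
elim: s => [|V s IH] sS; first by have [W SW] := S0; exists W.
have [|W SW Ws] := IH; first by move=> U Us; apply: sS; rewrite in_cons Us orbT.
exists (V `&` W); first by apply: SI => //; apply: sS; rewrite mem_head.
by move=> U; rewrite in_cons => /orP[/eqP->|/Ws UW] x [] // ? /UW.
Qed.

Lemma locfilt_core V W : S V -> S W ->
  exists2 W', S W' & forall v, V v -> W' `<=` conjs v W.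
Proof.
move=> SV SW; have SVW := SI SV SW.
have [fi _] := Scomm SV SW.
have fD : finite_set [set conjs v^-1 (V `&` W) | v in V].
  pose c (C : set G) : set G := [set x | exists y z, [/\ C y, C z & x = y^-1 * z]].
  apply: (sub_finite_set _ (finite_image c fi)).
  move=> _ [v Vv <-]; exists (rcoset (V `&` W) v); first by exists v.
  have sVW := Ssub SVW.
  apply/funext => x; rewrite conjsE invgK; apply/propext; split.
    move=> [y [z [yV zV ->]]].
    rewrite rcosetE in yV; rewrite rcosetE in zV.
    have := subgroupM sVW (subgroupV sVW yV) zV.
    by rewrite invgM invgK !mulgA.
  move=> Vx; exists v, (v * x); split.
  - exact: rcoset_id.
  - by rewrite rcosetE.
  - by rewrite mulgA mulVg mul1g.
have /finite_seqP[s sE] := fD.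
have [|W' SW' W's] := @finite_setI_filt s.
  move=> U Us; have : [set` s] U by [].
  by rewrite -sE => -[v _ <-]; apply: SJ.
exists W' => // v Vv x W'x.
have : [set` s] (conjs v (V `&` W)).
  rewrite -sE; exists v^-1; rewrite ?invgK //.
  by apply: subgroupV => //; apply: Ssub.
by move=> /W's /(_ _ W'x); rewrite conjsI => -[].
Qed.

(* A Cauchy filter for right cosets is one for left cosets. *)
Lemma cauchy_lcoset f V : S V -> exists g, f ((fun x => x^-1) @^-1` rcoset V g).
Proof.
move=> SV; have [g fg] := cauchy_ex f SV; have sV := Ssub SV.
have [W SW WP] := locfilt_core SV (SJ g SV).
have [k fk] := cauchy_ex f SW.
have [x [xW xV]] : rcoset W k `&` rcoset V g !=set0.
  by apply: (@cauchy_neq0 f); apply: (@filterI _ _ (cF f)).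
rewrite (rcoset_eq (Ssub SW) xW) in fk; exists x^-1.
apply: (@filterS _ _ (cF f) _ _ _ fk) => y; rewrite rcosetE /= rcosetE invgK.
move: xV; rewrite rcosetE => xV /(WP _ xV); rewrite conjsM !conjsE mulgVK.
by rewrite !mulgA mulgVK => /(subgroupV sV); rewrite invgM invgK.
Qed.

Lemma inv_is_cauchy f : is_cauchy (inv_sets (cauchy_sets f)).
Proof.
apply: is_cauchyI.
- split.
  + exact: (@filterT _ _ (cF f)).
  + by move=> A B fA fB; apply: (@filterI _ _ (cF f) _ _ fA fB).
  + by move=> A B AB; apply: (@filterS _ _ (cF f)) => x /AB.
- by move=> A /cauchy_neq0 [x Ax]; exists x^-1.
- by move=> V SV; apply: cauchy_lcoset.
- move=> A /cauchy_subP [V [g [SV fg VA]]].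
  exists (conjs g^-1 V), g^-1.
  have E y : rcoset (conjs g^-1 V) g^-1 y -> rcoset V g y^-1.
    rewrite !rcosetE conjsE !invgK !mulgA mulgK => /(subgroupV (Ssub SV)).
    by rewrite invgM.
  split; [exact: SJ| |].
    apply: (@filterS _ _ (cF f) _ _ _ fg) => y /=.
    rewrite !rcosetE conjsE !invgK !mulgA mulgK => /(subgroupV (Ssub SV)).
    by rewrite invgM invgK.
  by move=> y /E /VA /=; rewrite invgK.
Qed.

Definition completion_inv f : completion := Completion (inv_is_cauchy f).

Let one := completion_map 1.

Lemma completion_mulA : associative completion_mul.
Proof.
move=> f1 f2 f3; apply: cauchy_ext => V g SV.
move=> [A [B [f1A [B1 [B2 [f2B f3B BB]]] AB]]].
exists [set a * b | a in A & b in B1], B2; split=> //.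
  by exists A, B1; split.
move=> _ [_ [a Aa [b Bb <-]] [c Bc <-]]; apply: AB; exists a => //.
by exists (b * c); rewrite ?mulgA //; apply: BB; exists b => //; exists c.
Qed.

Lemma completion_mul1 : left_id one completion_mul.
Proof.
move=> f; apply/esym; apply: cauchy_ext => V g SV fV.
exists V, (rcoset V g); split=> //; first by exists V; rewrite ?rcoset1.
move=> _ [a Va [b Vb <-]]; move: Vb; rewrite !rcosetE -mulgA.
by apply: subgroupM => //; apply: Ssub.
Qed.

Lemma completion_mulV : left_inverse one completion_inv completion_mul.
Proof.
move=> f; apply/esym; apply: cauchy_ext => V g SV [W SW]; rewrite rcoset1 => WV.
have [h fh] := cauchy_lcoset f SV; have sV := Ssub SV.
exists (rcoset V h), ((fun x => x^-1) @^-1` rcoset V h); split=> //.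
have V1 : rcoset V g 1 by apply: WV; apply: subgroup1; apply: Ssub.
rewrite (rcoset_eq sV V1) rcoset1 => _ [a Va [b /= Vb <-]].
move: Va Vb; rewrite !rcosetE => Va /(subgroupV sV).
by rewrite invgM !invgK => Vb; have := subgroupM sV Va Vb; rewrite !mulgA mulgVK.
Qed.

Lemma completion_mulVr : right_inverse one completion_inv completion_mul.
Proof.
move=> f; apply/esym; apply: cauchy_ext => V g SV [W SW]; rewrite rcoset1 => WV.
have [h fh] := cauchy_ex f SV; have sV := Ssub SV.
exists (rcoset V h), ((fun x => x^-1) @^-1` rcoset V h); split=> //.
  by apply: (@filterS _ _ (cF f) _ _ _ fh) => y /=; rewrite invgK.
have V1 : rcoset V g 1 by apply: WV; apply: subgroup1; apply: Ssub.
rewrite (rcoset_eq sV V1) rcoset1 => _ [a Va [b /= Vb <-]].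
move: Va Vb; rewrite !rcosetE => Va /(subgroupV sV).
by rewrite invgM !invgK => Vb; have := subgroupM sV Va Vb; rewrite !mulgA mulgVK.
Qed.

Lemma completion_mul1r : right_id one completion_mul.
Proof.
move=> f; rewrite -(completion_mulV f) completion_mulA completion_mulVr.
exact: completion_mul1.
Qed.

HB.instance Definition _ := isGroup.Build completion completion_mulA
  completion_mul1 completion_mul1r completion_mulV completion_mulVr.

Definition coset_entourage W : set (completion * completion) :=
  [set p : completion * completion | exists g, p.1 (rcoset W g) /\ p.2 (rcoset W g)].

Definition completion_entourage : set_system (completion * completion) :=
  [set E | exists2 W, S W & coset_entourage W `<=` E].

Local Open Scope relation_scope.

Lemma coset_entourageS V W : S W -> V `<=` W ->
  coset_entourage V `<=` coset_entourage W.
Proof.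
move=> SW VW p [g [p1 p2]]; exists g.
have VWg : (rcoset V g `<=` rcoset W g)%classic by move=> x; rewrite !rcosetE => /VW.
by split; [move: p1; apply: (@filterS _ _ (cF p.1))|
  move: p2; apply: (@filterS _ _ (cF p.2))].
Qed.

Lemma completion_entourage_filter : Filter completion_entourage.
Proof.
split.
- by have [V SV] := S0; exists V.
- move=> E F [V SV VE] [W SW WF]; exists (V `&` W); first exact: SI.
  move=> p pVW; split; [apply: VE|apply: WF]; move: pVW;
    by apply: coset_entourageS => // x [].
- by move=> E F EF [V SV VE]; exists V => // p /VE /EF.
Qed.

Lemma completion_entourage_diag E : completion_entourage E -> diagonal `<=` E.
Proof.
move=> [V SV VE] [f f'] /= ff'; apply: VE.
have [g fg] := cauchy_ex f SV; exists g; split=> //=.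
by rewrite -[f']ff'.
Qed.

Lemma completion_entourage_inv E :
  completion_entourage E -> completion_entourage E^-1.
Proof.
move=> [V SV VE]; exists V => // -[f f'] [g [/= fg f'g]].
by apply: VE; exists g.
Qed.

Lemma completion_entourage_split E : completion_entourage E ->
  exists2 F, completion_entourage F & F \; F `<=` E.
Proof.
move=> [V SV VE]; exists (coset_entourage V); first by exists V.
move=> [f f'] /= [f1 [g [/= fg f1g]] [h [/= f1h f'h]]]; apply: VE.
by exists g; split=> //=; rewrite (cauchy_uniq SV f1g f1h).
Qed.

Local Close Scope relation_scope.

HB.instance Definition _ := isUniform.Build completion
  completion_entourage_filter completion_entourage_diag
  completion_entourage_inv completion_entourage_split.

Lemma completion_nbhsP f (N : set completion) : nbhs f N <->
  exists V g, [/\ S V, f (rcoset V g) &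
    forall f', f' (rcoset V g) -> N f'].
Proof.
split.
  move=> /nbhsP [E [V SV VE] EN]; have [g fg] := cauchy_ex f SV.
  exists V, g; split=> // f' f'g; apply: EN; apply/xsectionP; apply: VE.
  by exists g.
move=> [V [g [SV fg VN]]]; apply/nbhsP.
exists (coset_entourage V); first by exists V.
move=> f' /xsectionP [h [/= fh f'h]]; apply: VN.
by rewrite (cauchy_uniq SV fg fh).
Qed.

Lemma completion_mul_continuous :
  continuous (fun x : completion * completion => x.1 * x.2).
Proof.
move=> [f f'] N /= /completion_nbhsP [V [k [SV [A [B [fA f'B ABV]]] VN]]].
have [g fg] := cauchy_ex f SV.
have [h fh] := cauchy_ex f' (SJ g^-1 SV).
exists ([set f1 : completion | f1 (rcoset V g)],
        [set f1 : completion | f1 (rcoset (conjs g^-1 V) h)]).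
  split; apply/completion_nbhsP.
    by exists V, g.
  by exists (conjs g^-1 V), h; split=> //; apply: SJ.
move=> [f1 f2] [/= f1g f2h]; apply: VN.
exists (rcoset V g), (rcoset (conjs g^-1 V) h); split=> //.
have -> : rcoset V k = rcoset V (g * h).
  apply: (@cauchy_uniq (f * f')) => //; first by exists A, B.
  exists (rcoset V g), (rcoset (conjs g^-1 V) h); split=> //.
  by move=> _ [a Va [b Vb <-]]; apply: rcosetMP => //; apply: Ssub.
by move=> _ [a Va [b Vb <-]]; apply: rcosetMP => //; apply: Ssub.
Qed.

Lemma completion_inv_continuous :
  continuous (fun x : completion => x^-1).
Proof.
move=> f N /= /completion_nbhsP [V [k [SV fk VN]]].
have [W [g [SW fg WV]]] := @cauchy_subP f _ fk.
apply/completion_nbhsP; exists W, g; split=> // f' f'g; apply: VN.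
exact: (@filterS _ _ (cF f') _ _ WV).
Qed.

Lemma completion_hausdorff : hausdorff_space completion.
Proof.
move=> f f' cl; apply: cauchy_ext => V g SV fg.
have [h fh] := cauchy_ex f' SV.
have [f1 [f1g f1h]] : [set f1 : completion | f1 (rcoset V g)] `&`
    [set f1 : completion | f1 (rcoset V h)] !=set0.
  by apply: cl; apply/completion_nbhsP; [exists V, g|exists V, h].
by rewrite (cauchy_uniq SV f1g f1h).
Qed.

HB.instance Definition _ := isTopGroup.Build completion
  completion_mul_continuous completion_inv_continuous completion_hausdorff.

End Completion.

Record oc_subgroup (G : topGroupType) := OCSubgroup {
  oc_set :> set G;
  oc_is_subgroup : is_subgroup oc_set;
  oc_open : open oc_set;
  oc_commensurated : commensurated oc_set
}.

Section CommensurabilityClasses.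
Variables (G : topGroupType) (U : oc_subgroup G).

(* The set usually written [U]. *)
Definition comm_class : set (set G) :=
  [set V | [/\ is_subgroup V, closed V & commensurate U V]].

(* The set usually written S_{G/U}.  Allowing s to be empty only adds V = G,
   when U has finite index, and then U `<=` V anyway. *)
Definition schlichting_class : set (set G) :=
  [set V | comm_class V /\
    exists s : seq G, \bigcap_(g in [set` s]) conjs g U `<=` V].

Let sU : is_subgroup U. Proof. by case: U. Qed.

Lemma comm_class_self : comm_class U.
Proof.
split=> //; last exact: commensurate_refl.
by apply: open_subgroup_closed => //; apply: oc_open.
Qed.

Lemma comm_class_open V : comm_class V -> open V.
Proof.
move=> [sV cV [UV _]].
have sUV : is_subgroup (U `&` V) by apply: subgroupI.
have [_ cU _] := comm_class_self.
have oUV : open (U `&` V).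
  apply: (@closed_finite_index_open _ _ U) => //; first exact: closedI.
  exact: oc_open.
apply: (@open_superset _ (U `&` V)) => //; exact: subgroup1.
Qed.

Lemma comm_class_super V W : is_subgroup W -> V `<=` W -> finite_index V W ->
  comm_class V -> comm_class W.
Proof.
move=> sW VW fi cV; have oV := comm_class_open cV; have [sV _ UV] := cV.
split=> //.
  apply: open_subgroup_closed => //.
  apply: (@open_superset _ V) => //; exact: subgroup1.
exact/(commensurate_trans sU sV sW UV)/commensurate_super.
Qed.

Lemma comm_class_setI V W : comm_class V -> comm_class W ->
  comm_class (V `&` W).
Proof.
move=> [sV cV UV] [sW cW UW]; split; [exact: subgroupI|exact: closedI|].
exact: commensurate_setI.
Qed.

Lemma comm_class_conjs V g : comm_class V -> comm_class (conjs g V).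
Proof.
move=> [sV cV UV]; split; [exact: subgroup_conjs|exact: closed_conjs|].
apply: (@commensurate_trans _ _ (conjs g U)); try exact: subgroup_conjs.
- by [].
- exact: oc_commensurated.
- exact: commensurate_conjs.
Qed.

Lemma comm_class_comm V W : comm_class V -> comm_class W -> commensurate V W.
Proof.
move=> [sV _ UV] [sW _ UW].
exact: (commensurate_trans sV sU sW (commensurate_sym UV)).
Qed.

Lemma comm_class_local_filter : is_local_filter comm_class.
Proof.
split.
- by move=> V cV; split; [case: cV|apply: comm_class_open].
- by exists U; apply: comm_class_self.
- exact: comm_class_comm.
- exact: comm_class_setI.
- exact: comm_class_super.
- exact: comm_class_conjs.
Qed.

Lemma schlichting_class_local_filter : is_local_filter schlichting_class.
Proof.
split.
- by move=> V [cV _]; split; [case: cV|apply: comm_class_open].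
- exists U; split; first exact: comm_class_self.
  by exists [:: 1] => x /(_ 1); rewrite conjs1; apply; rewrite /= mem_head.
- by move=> V W [cV _] [cW _]; apply: comm_class_comm.
- move=> V W [cV [s sV]] [cW [t tW]]; split; first exact: comm_class_setI.
  exists (s ++ t) => x xst; split; [apply: sV|apply: tW] => g /= gs;
    by apply: xst; rewrite /= mem_cat gs ?orbT.
- move=> V W sW VW fi [cV [s sV]]; split; first exact: (comm_class_super _ VW).
  by exists s => x /sV /VW.
- move=> V g [cV [s sV]]; split; first exact: comm_class_conjs.
  exists [seq g * h | h <- s] => x xs; rewrite conjsE; apply: sV => h /= hs.
  have : conjs (g * h) U x by apply: xs; apply/mapP; exists h.
  by rewrite -conjsM conjsE.
Qed.

Definition comm_local_filter : local_filter G :=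
  LocalFilter comm_class_local_filter.

Definition schlichting_local_filter : local_filter G :=
  LocalFilter schlichting_class_local_filter.

End CommensurabilityClasses.

Notation belyaev_completion U := (completion (comm_local_filter U)).
Notation belyaev_map U := (completion_map (comm_local_filter U)).
Notation schlichting_completion U := (completion (schlichting_local_filter U)).
Notation schlichting_map U := (completion_map (schlichting_local_filter U)).

Definition tdlc (H : topGroupType) :=
  totally_disconnected [set: H] /\ locally_compact [set: H].

Record tdlc_completion_map (G H : topGroupType) (phi : G -> H) : Prop := {
  complmap_hom : {morph phi : x y / x * y};
  complmap_continuous : continuous phi;
  complmap_dense : dense (range phi);
  complmap_tdlc : tdlc H
}.

Record quotient_map (G H : topGroupType) (psi : G -> H) : Prop := {
  quotmap_hom : {morph psi : x y / x * y};
  quotmap_surj : range psi = setT;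
  quotmap_continuous : continuous psi;
  quotmap_open : forall A : set G, open A -> open (psi @` A)
}.

Definition ker (G H : topGroupType) (psi : G -> H) : set G := psi @^-1` [set 1].

Record compact_open_subgroup (H : topGroupType) (K : set H) : Prop := {
  cosub_subgroup : is_subgroup K;
  cosub_compact : compact K;
  cosub_open : open K
}.

Section Preimage.
Variables (G H : topGroupType) (phi : G -> H) (K : set H).
Hypothesis phiP : tdlc_completion_map phi.
Hypothesis KP : compact_open_subgroup K.

Let phiM := complmap_hom phiP.
Let sK := cosub_subgroup KP.

Lemma hom1 : phi 1 = 1.
Proof. by apply: (mulgI (phi 1)); rewrite -phiM !mulg1. Qed.

Lemma homV x : phi x^-1 = (phi x)^-1.
Proof. by apply: (mulgI (phi x)); rewrite -phiM !mulgV hom1. Qed.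

Lemma preim_subgroup (L : set H) : is_subgroup L -> is_subgroup (phi @^-1` L).
Proof.
move=> sL; split; rewrite /preimage /=.
- by rewrite hom1; apply: subgroup1.
- by move=> x y Lx Ly; rewrite phiM; apply: subgroupM.
- by move=> x Lx; rewrite homV; apply: subgroupV.
Qed.

Lemma preim_finite_index (L M : set H) : is_subgroup L -> finite_index L M ->
  finite_index (phi @^-1` L) (phi @^-1` M).
Proof.
move=> sL fi.
apply: (sub_finite_set _ (finite_image (fun C => phi @^-1` C) fi)).
move=> _ [w Mw <-]; exists (rcoset L (phi w)); first by exists (phi w).
by apply/funext => x; rewrite rcosetE /preimage /= rcosetE phiM homV.
Qed.

Lemma compact_open_finite_index (L : set H) : is_subgroup L -> open L ->
  finite_index L K.
Proof.
move=> sL oL; apply: finite_indexP => //.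
pose T : ptopologicalType := HB.pack_for ptopologicalType (TopGroup.sort H) (TopGroup.on H) (isPointed.Build H 1).
have := cosub_compact KP; have -> := @compact_cover T.
move=> /(_ T K (rcoset L)) [|x Kx|D' _ D'K].
- by move=> k _; apply: open_rcoset.
- by exists x => //; apply: rcoset_id.
by exists (finmap.enum_fset D') => w /D'K [t tD']; rewrite rcosetE; exists t.
Qed.

Lemma preim_commensurated : commensurated (phi @^-1` K).
Proof.
have KI g : finite_index (K `&` conjs g K) K.
  apply: compact_open_finite_index; first exact/subgroupI/subgroup_conjs.
  apply: openI; [|apply: open_conjs]; exact: cosub_open.
have E g : conjs g (phi @^-1` K) = phi @^-1` conjs (phi g) K.
  by apply/funext => x; rewrite conjsE /preimage /= conjsE !phiM homV.
have KJ g : is_subgroup (K `&` conjs g K) by apply/subgroupI/subgroup_conjs.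
move=> g; rewrite /commensurate E -preimage_setI; split.
  exact: preim_finite_index.
apply: preim_finite_index => //.
have := finite_index_conjs (phi g) (KI (phi g)^-1).
by rewrite conjsI conjsM mulgV conjs1 setIC.
Qed.

Lemma preim_open : open (phi @^-1` K).
Proof.
apply: open_comp; last exact: cosub_open.
by move=> x _; apply: (complmap_continuous phiP).
Qed.

Definition preim_oc : oc_subgroup G :=
  @OCSubgroup G (phi @^-1` K) (preim_subgroup sK) preim_open preim_commensurated.

End Preimage.

(* Main.v *)
Require Import Defs.
From mathcomp Require Import all_boot all_classical.
From mathcomp Require Import topology.

(** The point is that both maps are proper.  Write [S] for either of the two
local filters, and [f V] for the assertion that the Cauchy filter [f] contains
[V], i.e. that [f] lies in the closure of the image of [V] in the completion.

For [V] in [S] the open subgroup of those [f] with [f V] is compact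
([compact_cauchy]): any [W] in [S] is commensurate with [V], so finitely many
cosets of [W] cover [V], and an ultrafilter has to settle on one of them.  This
gives the principle behind both halves ([proper_quotient_map],
[proper_compact_ker]): a continuous homomorphism with dense range is a quotient
map with compact kernel as soon as one open subgroup [D] of the target has a
compact preimage.  Indeed the image of that preimage is closed and dense in
[D], hence all of [D]; the kernel is closed in the preimage; and a continuous
map from a compact space to a Hausdorff space is closed, which becomes openness
after passing to complements of saturated sets.

The map [psi1] sends a Cauchy filter [f] to the limit of its image under [phi]
in [H] ([limit]).  A limit exists because the image of [f] contains a coset of
the compact group [K], hence clusters somewhere, and because the open subgroups
[L] of [K] have preimages in [U]'s commensurability class, so that the image of
[f] contains exactly one coset of each [L].  It is unique, and the
map is continuous, because these [L] form a basis of neighbourhoods of the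
identity; this is van Dantzig's theorem ([van_dantzig]), the only place where
total disconnectedness of [H] enters.  The preimage of [K] under [psi1] is the
compact subgroup of those [f] with [f U].

The map [psi2] sends [h] to the filter generated by the sets
[phi^-1 (N h)], where [N] runs over the open subgroups of [H] whose preimage
belongs to [S] ([extension]).  This is Cauchy as soon as these preimages are
cofinal in [S]; for the Schlichting local filter they are, because a finite
intersection of conjugates of [U] is the preimage of the corresponding
intersection of conjugates of [K].  The preimage of the subgroup of those [f]
with [f U] is [K].

That the maps are homomorphisms, and that they are the only ones, follows from
the density of the images of [G] in the completion and in [H]. *)

Set Implicit Arguments.
Unset Strict Implicit.
Unset Printing Implicit Defensive.

Local Open Scope classical_set_scope.
Local Open Scope group_scope.

(** * Clopen neighbourhoods in totally disconnected spaces *)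

Section ClopenBase.
Variable T : topologicalType.
Hypothesis hT : hausdorff_space T.

Definition clopen_within (K : set T) (x : T) : set (set T) :=
  [set D | [/\ clopen D, D x & D `<=` K]].

Lemma clopen_within_filter (K : set T) x : clopen K -> K x ->
  Filter (filter_from (clopen_within K x) id).
Proof.
move=> cK Kx; apply: filter_from_filter; first by exists K; split.
move=> A B [cA Ax AK] [cB Bx BK]; exists (A `&` B) => //.
by split; [exact: clopenI| |move=> y [/AK]].
Qed.

(** Compactness upgrades avoiding the points of [X] one at a time to avoiding
all of [X] at once. *)
Lemma clopen_within_avoid (K : set T) x (X : set T) :
  compact K -> clopen K -> K x -> closed X ->
  (forall y, X y -> exists2 D, clopen_within K x D & ~ D y) ->
  exists2 D, clopen_within K x D & D `<=` ~` X.
Proof.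
move=> cK oK Kx cX XQ.
have FF := clopen_within_filter oK Kx.
(* The covering property is applied to the relation [y <> i] between a point
   [y] of [X] and a point [i] tending to [x] along the clopen sets: its uniform
   version says that a single clopen set misses [X]. *)
have /compact_near_coveringP/(_ T (filter_from (clopen_within K x) id)
    (fun i y => y <> i)) : compact (K `&` X) by exact: compact_closedI.
case=> [y [_ /XQ [D DP nDy]]|D DP DX].
  exists (~` D, D) => /=.
    split; last by exists D.
    case: DP => -[_ cD] _ _.
    by apply: open_nbhs_nbhs; split=> //; apply: closed_openC.
  by move=> [z i] [/= nDz Di] zi; apply: nDz; rewrite zi.
exists D => // y Dy Xy; apply: (DX y Dy y) => //; split=> //.
by case: DP => _ _; apply.
Qed.

(** The intersection [Q] of the clopen neighbourhoods of [x] is its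
quasi-component.  If [Q] were the disjoint union of two closed sets [A] and
[B], these could be separated by an open [V] containing [A] whose closure misses
[B]; some clopen [D] would miss the boundary of [V], so that [D `&` V] would
be a clopen neighbourhood of [x] missing [B]. *)
Lemma quasi_component_connected (K : set T) x :
  compact K -> clopen K -> K x ->
  connected (\bigcap_(D in clopen_within K x) D).
Proof.
move=> cK oK Kx; set Q := bigcap _ _.
have KK : clopen_within K x K by split.
have QK : Q `<=` K by move=> y /(_ K KK).
have Qx : Q x by move=> D [].
have cQ : closed Q by apply: closed_bigI => D [[]].
have main A B : closed A -> closed B -> A x -> A `&` B = set0 ->
    Q `<=` A `|` B -> Q `<=` A.
  move=> cA cB Ax AB0 QAB.
  have nB : set_nbhs (Q `&` A) (~` B).
    apply/set_nbhsP; exists (~` B); split=> //; first exact: closed_openC.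
    by move=> y [_ Ay] By; have : (A `&` B) y by []; rewrite AB0.
  have QAK : Q `&` A `<=` K^°.
    by move=> y [/QK Ky _]; apply: open_nbhs_nbhs; split=> //; case: oK.
  have [W /set_nbhsP[V [oV QAV VW]] WB] :=
    compact_normal_local hT cK QAK (closedI cQ cA) nB.
  have [|y [Vy nVy]|D [[oD cD] Dx DK] DX] :=
    clopen_within_avoid (X := closure V `&` ~` V) cK oK Kx.
  - by apply: closedI; [exact: closed_closure|exact: open_closedC].
  - apply: contrapT => nD; have Qy : Q y.
      by move=> D DP; apply: contrapT => Dy; apply: nD; exists D.
    have [Ay|By] := QAB _ Qy; first by apply: nVy; apply: QAV.
    by apply: (WB y) => //; apply: (closureS VW).
  have DV : D `&` V = D `&` closure V.
    apply/seteqP; split=> y [Dy Vy]; split=> //; first exact: subset_closure.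
    by apply: contrapT => nVy; apply: (DX y Dy); split.
  have QV : Q `<=` D `&` V.
    move=> y; apply; split; last by move=> z [/DK].
      by split; [exact: openI|rewrite DV; apply: closedI => //; exact: closed_closure].
    by split=> //; apply: QAV; split.
  move=> y Qy; have [//|By] := QAB y Qy; have [_ Vy] := QV y Qy.
  by have := WB y; case=> //; apply: subset_closure; apply: VW.
move=> B [b Bb] [C oC BC] [C' cC' BC'].
have cB : closed B by rewrite BC'; apply: closedI.
have cQB : closed (Q `&` ~` C) by apply: closedI => //; exact: open_closedC.
have dis : B `&` (Q `&` ~` C) = set0.
  by rewrite -subset0 => y []; rewrite {1}BC => -[_ Cy] [_].
have BQ : B `<=` Q by rewrite BC => y [].
have cov y : Q y -> B y \/ (Q `&` ~` C) y.
  move=> Qy; have [Cy|nCy] := pselect (C y); last by right.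
  by left; rewrite BC.
apply/seteqP; split=> //.
have [Bx|nBx] := pselect (B x); first exact: (main B (Q `&` ~` C)).
have [//|QCx] := cov x Qx.
have /(_ b (BQ b Bb)) [_ nCb] : Q `<=` Q `&` ~` C.
  by apply: (main _ B) => //; [rewrite setIC|move=> y /cov[]; [right|left]].
by move: Bb; rewrite {1}BC => -[].
Qed.

(** Total disconnectedness reduces the connected quasi-component of [x] to
[x] itself, so every point outside [N] is missed by a clopen set. *)
Lemma clopen_base (K N : set T) x : totally_disconnected [set: T] ->
  compact K -> clopen K -> K x -> nbhs x N ->
  exists2 D, clopen_within K x D & D `<=` N.
Proof.
move=> td cK oK Kx nN.
have [|y nNy|D DP DN] := clopen_within_avoid (X := ~` N^°) cK oK Kx.
- exact/open_closedC/open_interior.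
- apply: contrapT => nD; apply: nNy.
  have Qy : (\bigcap_(D in clopen_within K x) D) y.
    by move=> D DP; apply: contrapT => Dy; apply: nD; exists D.
  have Qx : (\bigcap_(D in clopen_within K x) D) x by move=> D [].
  have := connected_component_max Qx (@subsetT _ _)
    (quasi_component_connected cK oK Kx).
  rewrite td // => /(_ y Qy) ->.
  exact: nN.
- by exists D => // y /DN; rewrite setCK; exact: interior_subset.
Qed.
End ClopenBase.

(** * Van Dantzig's theorem *)

Section VanDantzig.
Variable H : topGroupType.

Lemma compact_nbhs1 (C N : set H) : compact C -> open N -> C `<=` N ->
  \forall x \near (1 : H), forall c, C c -> N (c * x).
Proof.
move=> /compact_near_coveringP cC oN CN.
apply: (cC H (nbhs (1 : H)) (fun x c => N (c * x))) => c Cc.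
have := @mulg_continuous H (c, 1) N; rewrite /= mulg1; apply.
by apply: open_nbhs_nbhs; split=> //; apply: CN.
Qed.

(** The subgroup is the stabiliser of a compact clopen set [D] under right
translation: it is contained in [D] because [1] is in [D], and it is open
because [D] is compact and open. *)
Lemma van_dantzig (K N : set H) : totally_disconnected [set: H] ->
  compact_open_subgroup K -> nbhs (1 : H) N ->
  exists L, [/\ is_subgroup L, open L, L `<=` K & L `<=` N].
Proof.
move=> td [sK cK oK] nN.
have K1 := subgroup1 sK; have cloK : closed K by exact: open_subgroup_closed.
have [D [[oD cD] D1 DK] DN] :=
  clopen_base (@topgroup_hausdorff H) td cK (conj oK cloK) K1 nN.
have nL := compact_nbhs1 (subclosed_compact cD cK DK) oD (fun _ h => h).
pose L := [set x | forall c, D (c * x) <-> D c].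
have sL : is_subgroup L.
  split=> [c|x y Lx Ly c|x Lx c]; first by rewrite mulg1.
    by rewrite mulgA; split=> [/Ly/Lx|/Lx/Ly].
  by rewrite -(Lx (c * x^-1)) mulgVK.
have LD : L `<=` D by move=> x /(_ 1); rewrite mul1g => ->.
exists L; split=> // [|x /LD /DK|x /LD /DN] //.
have nL' : nbhs (1 : H) L.
  have nV : \forall x \near (1 : H), forall c, D c -> D (c * x^-1).
    have := @invg_continuous H 1 (fun x => forall c, D c -> D (c * x)).
    by rewrite invg1; exact.
  apply: filterS2 nL nV => x xP xVP c; split; last exact: xP.
  by move=> /xVP; rewrite mulgK.
have [O [oO O1] OL] : exists2 O, open_nbhs (1 : H) O & O `<=` L.
  by move: nL'; rewrite nbhsE.
exact: (open_superset sL OL).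
Qed.

End VanDantzig.

(** * Homomorphisms determined on a dense subset *)

Section DenseMaps.

Lemma dense_continuous_eq (T T' : topologicalType) (D : set T) (f g : T -> T') :
  hausdorff_space T' -> dense D -> continuous f -> continuous g ->
  (forall x, D x -> f x = g x) -> f = g.
Proof.
move=> hT dD cf cg fg; apply/funext => x; apply: hT => A B nA nB.
have : nbhs x (f @^-1` A `&` g @^-1` B).
  by apply: filterI; [exact: cf|exact: cg].
rewrite nbhsE => -[O [oO Ox] OAB].
have [y [/OAB [Ay By] Dy]] := dD O (ex_intro _ x Ox) oO.
by exists (f y); split=> //; rewrite fg.
Qed.

(** Both sides of the morphism identity are continuous in each variable
separately, so the identity extends to all of [A] one variable at a time. *)
Lemma dense_hom (A B : topGroupType) (D : set A) (f : A -> B) : dense D ->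
  continuous f -> (forall x y, D x -> D y -> f (x * y) = f x * f y) ->
  {morph f : x y / x * y}.
Proof.
move=> dD cf fM.
have comp (X Y Z : topologicalType) (g : X -> Y) (h : Y -> Z) :
    continuous g -> continuous h -> continuous (fun x => h (g x)).
  by move=> cg ch x; apply: (@continuous_comp _ _ _ g h); [exact: cg|exact: ch].
have cl a : continuous (fun y => f (a * y)) by apply: comp cf; exact: mulgl_continuous.
have cr a : continuous (fun y => f (y * a)) by apply: comp cf; exact: mulgr_continuous.
have cl' b : continuous (fun y => b * f y).
  by apply: (comp _ _ _ f (fun z => b * z)); last exact: mulgl_continuous.
have cr' b : continuous (fun y => f y * b).
  by apply: (comp _ _ _ f (fun z => z * b)); last exact: mulgr_continuous.
have eqB := dense_continuous_eq (@topgroup_hausdorff B) dD.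
have half x y : D x -> f (x * y) = f x * f y.
  move=> Dx; have E : (fun y => f (x * y)) = (fun y => f x * f y).
    by apply: eqB => // z; exact: fM.
  by rewrite -[RHS]/((fun y => f x * f y) y) -E.
move=> x y; have E : (fun x => f (x * y)) = (fun x => f x * f y).
  by apply: eqB => // z; exact: half.
by rewrite -[RHS]/((fun x => f x * f y) x) -E.
Qed.

End DenseMaps.

(** * Proper homomorphisms with dense range *)

Lemma compact_rcoset (A : topGroupType) (C : set A) a :
  compact C -> compact (rcoset C a).
Proof.
move=> cC; apply: continuous_compact cC; apply: continuous_subspaceT => x.
exact: mulgr_continuous.
Qed.

Section ProperHom.
Variables (A B : topGroupType) (psi : A -> B) (D : set B).
Hypothesis psiM : {morph psi : x y / x * y}.
Hypothesis psi_cont : continuous psi.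
Hypothesis psi_dense : dense (range psi).
Hypotheses (sD : is_subgroup D) (oD : open D).
Hypothesis cD : compact (psi @^-1` D).

Let psi1 : psi 1 = 1.
Proof. by apply: (mulgI (psi 1)); rewrite -psiM !mulg1. Qed.

Let psiV x : psi x^-1 = (psi x)^-1.
Proof. by apply: (mulgI (psi x)); rewrite -psiM !mulgV psi1. Qed.

Let compact_image_closed (X : set A) : compact X -> closed (psi @` X).
Proof.
move=> cX; apply: compact_closed; first exact: topgroup_hausdorff.
by apply: continuous_compact => //; exact: continuous_subspaceT.
Qed.

(** The image of the compact preimage of [D] is closed, so a point of [D]
outside it would have a neighbourhood missing the dense range. *)
Let preim_image : D `<=` psi @` (psi @^-1` D).
Proof.
move=> b Db; apply: contrapT => nb.
have [||c [[Dc nc] [a _ ac]]] := psi_dense (O := D `&` ~` (psi @` (psi @^-1` D))).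
- by exists b.
- by apply: openI => //; apply: closed_openC; exact: compact_image_closed.
- by apply: nc; exists a; rewrite /preimage /= ?ac.
Qed.

Let psi_surj b : exists a, psi a = b.
Proof.
have [||c [Dc [a _ ac]]] := psi_dense (O := rcoset D b).
- by exists b; exact: rcoset_id.
- exact: open_rcoset.
- move: Dc; rewrite -ac rcosetE => /preim_image [d _ dE].
  by exists (d^-1 * a); rewrite psiM psiV dE invgM invgK mulgVK.
Qed.

Let saturation_open (O : set A) : open O -> open (psi @^-1` (psi @` O)).
Proof.
move=> oO; have -> : psi @^-1` (psi @` O) = \bigcup_(k in ker psi) rcoset O k.
  apply/seteqP; split=> [x [y Oy yx]|x [k kk]].
    exists (y^-1 * x); first by rewrite /ker /preimage /= psiM psiV yx mulVg.
    by rewrite rcosetE invgM invgK mulgA mulgV mul1g.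
  rewrite rcosetE => Ox; exists (x * k^-1) => //.
  by rewrite psiM psiV kk invg1 mulg1.
by apply: bigcup_open => k _; exact: open_rcoset.
Qed.

(** Openness at [psi a], with [a] in [O]: within the open coset [D * psi a],
the complement of the image of [O] is the image of the compact set [X], hence
closed. *)
Lemma proper_quotient_map : quotient_map psi.
Proof.
split=> //.
  by apply/seteqP; split=> // b _; have [a <-] := psi_surj b; exists a.
move=> O oO; rewrite openE => _ [a Oa <-].
pose P := psi @^-1` (psi @` O).
pose X := rcoset (psi @^-1` D) a `&` ~` P.
have cX : compact X.
  apply: compact_closedI; last by apply: open_closedC; exact: saturation_open.
  exact: compact_rcoset.
pose W := rcoset D (psi a) `&` ~` (psi @` X).
rewrite /interior nbhsE; exists W.
  split; first by apply: openI; [exact: open_rcoset|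
    apply: closed_openC; exact: compact_image_closed].
  split; first exact: rcoset_id.
  by move=> [x [_ nP] xa]; apply: nP; exists a.
move=> w [Dw nw]; have [x xw] := psi_surj w.
suff : P x by rewrite /P /preimage /= xw.
apply: contrapT => nP; apply: nw; exists x => //; split=> //.
by rewrite rcosetE /preimage /= psiM psiV -rcosetE xw.
Qed.

Lemma proper_compact_ker : compact (ker psi).
Proof.
apply: (subclosed_compact _ cD).
  apply: (continuous_closedP _).1 => //.
  by apply: compact_closed; [exact: topgroup_hausdorff|exact: compact_set1].
by move=> x kx; rewrite /preimage /= kx; exact: subgroup1.
Qed.

End ProperHom.

Lemma proper_unique_quotient (X : Type) (A B : topGroupType)
    (a : X -> A) (b : X -> B) (psi : A -> B) (D : set B) :
  dense (range a) -> dense (range b) -> psi \o a = b ->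
  {morph psi : x y / x * y} -> continuous psi ->
  is_subgroup D -> open D -> compact (psi @^-1` D) ->
  exists! psi : A -> B, [/\ quotient_map psi, compact (ker psi) & psi \o a = b].
Proof.
move=> da db psiab psiM psiC sD oD cD; exists psi; split.
  split=> //; last exact: (proper_compact_ker psiC sD cD).
  apply: (proper_quotient_map psiM psiC _ sD oD cD) => O O0 oO.
  have [y [Oy [x _ xy]]] := db O O0 oO.
  by exists y; split=> //; exists (a x); rewrite // -xy -psiab.
move=> psi' [[_ _ psiC' _] _ psiE'].
apply: (dense_continuous_eq (@topgroup_hausdorff B) da) => //.
by move=> _ [x _ <-]; rewrite -[LHS]/((psi \o a) x) psiab -psiE'.
Qed.

(** * Density and compactness in completions *)

Section CompletionTopology.
Variables (G : topGroupType) (S : local_filter G).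
Implicit Types (V W : set G) (f : completion S).

Lemma locfilt_subgroup V : S V -> is_subgroup V.
Proof. by case/(locfilt_open (locfilt_is_local_filter S)). Qed.

Lemma cauchy_is_filter f : Filter (cauchy_sets f).
Proof. by case: f => ? []. Qed.

Lemma open_cauchy_coset V g : S V -> open [set f : completion S | f (rcoset V g)].
Proof.
by move=> SV; rewrite openE => f fV; apply/completion_nbhsP; exists V, g.
Qed.

Lemma open_cauchy V : S V -> open [set f : completion S | f V].
Proof. by move=> SV; rewrite -(rcoset1 V); exact: open_cauchy_coset. Qed.

Lemma subgroup_cauchy V : S V -> is_subgroup [set f : completion S | f V].
Proof.
move=> SV; have sV := locfilt_subgroup SV; split.
- by exists V; rewrite ?rcoset1.
- move=> f f' fV f'V; exists V, V; split=> // _ [a Va [b Vb <-]].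
  exact: subgroupM.
- move=> f fV; apply: (@filterS _ _ (cauchy_is_filter f) V) => // x Vx.
  exact: subgroupV.
Qed.

Lemma dense_completion_map : dense (range (completion_map S)).
Proof.
move=> O [f Of]; rewrite openE => /(_ f Of) /completion_nbhsP.
move=> [V [g [SV _ VO]]]; exists (completion_map S g); split; last by exists g.
by apply: VO; exists V.
Qed.

Lemma cauchy_fin_coset V W : S V -> S W -> exists s : seq G,
  forall f, f V -> exists2 t, t \in s & f (rcoset W t).
Proof.
move=> SV SW; have sW := locfilt_subgroup SW.
have [fi _] := locfilt_comm (locfilt_is_local_filter S) SV SW.
have [s sP] := finite_index_seq (subgroupI (locfilt_subgroup SV) sW) fi.
exists s => f fV; have [g fg] := Defs.cauchy_ex f SW.
have [v [Vv gv]] : V `&` rcoset W g !=set0.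
  by apply: (@cauchy_neq0 _ S f); apply: (@filterI _ _ (cauchy_is_filter f)).
have [t ts [_ Wt]] := sP v Vv; exists t => //.
by rewrite (@rcoset_eq _ W t v) ?rcosetE // -(rcoset_eq sW gv).
Qed.

Lemma ultra_exists_seq (T : Type) (F : set_system T) (I : eqType) (s : seq I)
    (P : I -> set T) : UltraFilter F ->
  F [set x | exists2 i, i \in s & P i x] -> exists2 i, i \in s & F (P i).
Proof.
move=> UF; elim: s => [|i s IH] Fs.
  have : F set0 by apply: filterS Fs => x [].
  by move/filter_ex => [].
have [Fi|Fni] := in_ultra_setVsetC (P i) UF.
  by exists i => //; exact: mem_head.
have [|j js Fj] := IH; last by exists j; rewrite // in_cons js orbT.
apply: filterS2 Fs Fni => x [j + Pj] nPi; rewrite in_cons => /orP[/eqP ji|js].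
  by move: Pj; rewrite ji.
by exists j.
Qed.

(** An ultrafilter [F] containing this set selects one coset of each [W] in
[S]; the filter [lim_sets] generated by the selected cosets is Cauchy, and [F]
converges to it. *)
Lemma compact_cauchy V : S V -> compact [set f : completion S | f V].
Proof.
move=> SV; rewrite compact_ultra => F UF FV.
pose lim_sets : set_system G := [set A | exists W g,
  [/\ S W, F [set f : completion S | f (rcoset W g)] & rcoset W g `<=` A]].
have FF : Filter F by apply: filter_filter.
have F_meet W g W' g' : S W -> S W' ->
    F [set f : completion S | f (rcoset W g)] ->
    F [set f : completion S | f (rcoset W' g')] ->
    exists h, rcoset (W `&` W') h = rcoset W g `&` rcoset W' g' /\
      F [set f : completion S | f (rcoset (W `&` W') h)].
  move=> SW SW' Fg Fg'.
  have [sW sW'] := (locfilt_subgroup SW, locfilt_subgroup SW').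
  have Fgg' : F [set f : completion S | f (rcoset W g `&` rcoset W' g')].
    apply: filterS2 Fg Fg' => f fg fg'.
    exact: (@filterI _ _ (cauchy_is_filter f)).
  have [f /= /cauchy_neq0 [h [gh gh']]] := filter_ex Fgg'.
  suff E : rcoset (W `&` W') h = rcoset W g `&` rcoset W' g'.
    by exists h; split=> //; rewrite E.
  rewrite (rcoset_eq sW gh) (rcoset_eq sW' gh').
  by apply/funext => x; rewrite /setI /= !rcosetE.
have lim_coset W : S W -> exists g, F [set f : completion S | f (rcoset W g)].
  move=> SW; have [s sP] := cauchy_fin_coset SV SW.
  have [|g _ Fg] := @ultra_exists_seq _ F _ s (fun t => [set f : completion S | f (rcoset W t)]) UF.
    by apply: filterS FV => f /sP.
  by exists g.
have limP : is_cauchy S lim_sets.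
  apply: is_cauchyI.
  - split.
    + have [g Fg] := lim_coset V SV; exists V, g; split=> //.
    + move=> A B [W [g [SW Fg WA]]] [W' [g' [SW' Fg' WB]]].
      have [h [E Fh]] := F_meet _ _ _ _ SW SW' Fg Fg'.
      exists (W `&` W'), h; split=> //.
        exact: (locfilt_setI (locfilt_is_local_filter S)).
      by rewrite E => x [/WA ? /WB].
    + by move=> A B AB [W [g [SW Fg WA]]]; exists W, g; split=> // x /WA /AB.
  - move=> A [W [g [SW _ WA]]]; exists g; apply: WA; apply: rcoset_id.
    exact: locfilt_subgroup.
  - by move=> W SW; have [g Fg] := lim_coset W SW; exists g, W, g; split.
  - by move=> A [W [g [SW Fg WA]]]; exists W, g; split=> //; exists W, g; split.
exists (Completion limP); split.
  by exists V, 1; split; rewrite ?rcoset1.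
move=> N /completion_nbhsP [W [g [SW [W' [g' [SW' Fg' W'W]]] WN]]].
apply: filterS Fg' => f fg'; apply: WN.
exact: (@filterS _ _ (cauchy_is_filter f) _ _ W'W).
Qed.

End CompletionTopology.

(** * Completion maps and local filters *)

Section DenseHom.
Variables (G H : topGroupType) (phi : G -> H).
Hypothesis phiP : tdlc_completion_map phi.
Variable S : local_filter G.

Let SP := locfilt_is_local_filter S.

Lemma completion_mapM : {morph completion_map S : x y / x * y}.
Proof.
move=> x y; apply: cauchy_ext => V g SV [W SW WV].
have sW := locfilt_subgroup SW.
exists (rcoset W x), (rcoset (conjs x^-1 W) y); split.
- by exists W.
- by exists (conjs x^-1 W) => //; exact: (locfilt_conjs SP).
- by move=> _ [a Wa [b Wb <-]]; apply: WV; exact: rcosetMP.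
Qed.

Lemma preim_rcoset (L : set H) g :
  phi @^-1` rcoset L (phi g) = rcoset (phi @^-1` L) g.
Proof.
apply/funext => x.
by rewrite rcosetE /preimage /= rcosetE (complmap_hom phiP) (homV phiP).
Qed.

Lemma preim_conjs (L : set H) g :
  phi @^-1` conjs (phi g) L = conjs g (phi @^-1` L).
Proof.
apply/funext => x.
by rewrite conjsE /preimage /= conjsE !(complmap_hom phiP) (homV phiP).
Qed.

Lemma open_rcoset_rep (L : set H) h : is_subgroup L -> open L ->
  exists g, rcoset L h = rcoset L (phi g).
Proof.
move=> sL oL.
have [||y [Ly [g _ gy]]] := complmap_dense phiP (O := rcoset L h).
- by exists h; exact: rcoset_id.
- exact: open_rcoset.
- by exists g; rewrite gy; exact: rcoset_eq.
Qed.

(** * The map from the completion group to a coarser completion *)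

Section Extension.

Definition open_trace : set (set H) :=
  [set N | [/\ is_subgroup N, open N & S (phi @^-1` N)]].

Hypothesis trace_cofinal : forall V, S V ->
  exists2 N, open_trace N & phi @^-1` N `<=` V.

Definition extension_sets (h : H) : set_system G :=
  [set A | exists2 N, open_trace N & phi @^-1` rcoset N h `<=` A].

Lemma open_traceI M N : open_trace M -> open_trace N -> open_trace (M `&` N).
Proof.
move=> [sM oM SM] [sN oN SN]; split; [exact: subgroupI|exact: openI|].
by rewrite preimage_setI; exact: (locfilt_setI SP).
Qed.

Lemma open_traceJ N g : open_trace N -> open_trace (conjs (phi g) N).
Proof.
move=> [sN oN SN]; split; [exact: subgroup_conjs|exact: open_conjs|].
by rewrite preim_conjs; exact: (locfilt_conjs SP).
Qed.

(** By density every coset [N h] equals some [N (phi g)], whose preimage is a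
coset in [G]. *)
Lemma extension_is_cauchy h : is_cauchy S (extension_sets h).
Proof.
have rep N : open_trace N -> exists g, rcoset N h = rcoset N (phi g).
  by move=> [sN oN _]; exact: open_rcoset_rep.
apply: is_cauchyI.
- split.
  + have [V SV] := locfilt_neq0 SP; have [N tN _] := trace_cofinal SV.
    by exists N.
  + move=> A B [M tM MA] [N tN NB]; exists (M `&` N); first exact: open_traceI.
    move=> x; rewrite /preimage /= rcosetE => -[Mx Nx].
    by split; [apply: MA|apply: NB]; rewrite /preimage /= rcosetE.
  + by move=> A B AB [N tN NA]; exists N => // x /NA /AB.
- move=> A [N tN NA]; have [g E] := rep N tN; exists g; apply: NA.
  by rewrite /preimage /= E; apply: rcoset_id; case: tN.
- move=> V SV; have [N tN NV] := trace_cofinal SV; have [g E] := rep N tN.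
  exists g, N => //; rewrite E preim_rcoset => x.
  by rewrite !rcosetE => /NV.
- move=> A [N tN NA]; have [g E] := rep N tN; exists (phi @^-1` N), g.
  rewrite -preim_rcoset -E; split=> //; first by case: tN.
  by exists N.
Qed.

Definition extension (h : H) : completion S := Completion (extension_is_cauchy h).

Lemma extension_phi : extension \o phi = completion_map S.
Proof.
apply/funext => g; apply: cauchy_ext => V k SV [N [_ _ SN]].
by rewrite preim_rcoset => NV; exists (phi @^-1` N).
Qed.

Lemma extension_continuous : continuous extension.
Proof.
move=> h A /completion_nbhsP [V [g [SV [N tN NV] VA]]].
rewrite /= nbhsE; exists (rcoset N h).
  by case: tN => sN oN _; split; [exact: open_rcoset|exact: rcoset_id].
move=> k Nk; apply: VA; exists N => //.
by case: tN => sN _ _; rewrite -(rcoset_eq sN Nk).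
Qed.

Lemma extensionM : {morph extension : x y / x * y}.
Proof.
apply: (dense_hom (complmap_dense phiP) extension_continuous).
move=> _ _ [x _ <-] [y _ <-]; rewrite -(complmap_hom phiP).
have E z : extension (phi z) = completion_map S z by rewrite -extension_phi.
by rewrite !E completion_mapM.
Qed.

(** If [extension h] contains the preimage of [N], this is witnessed by a coset
[M h]; a point of [G] mapped into the open set [(M `&` N) h] is then mapped
into [N], which forces [N h] to be [N]. *)
Lemma extension_preim N h : open_trace N -> extension h (phi @^-1` N) <-> N h.
Proof.
move=> tN; have [sN oN SN] := tN; split=> [[M tM MN]|Nh]; last first.
  by exists N => //; rewrite -(@rcoset_eq _ N 1 h sN) ?rcoset1.
have [sI oI _] := open_traceI tM tN.
have [g E] := open_rcoset_rep h sI oI.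
have : rcoset (M `&` N) h (phi g) by rewrite E; exact: rcoset_id.
rewrite rcosetE => -[Mg Ng].
have /MN Ng' : (phi @^-1` rcoset M h) g by rewrite /preimage /= rcosetE.
have := subgroupM sN (subgroupV sN Ng) Ng'.
by rewrite invgM invgK mulgVK.
Qed.

End Extension.

(** * The map from a finer completion to the completion group *)

Section Limit.
Variable K : set H.
Hypothesis KP : compact_open_subgroup K.

Definition small_subgroup : set (set H) :=
  [set L | [/\ is_subgroup L, open L & L `<=` K]].

Hypothesis S_small : forall L, small_subgroup L -> S (phi @^-1` L).

Lemma small_rcoset_nbhs h N : nbhs h N ->
  exists2 L, small_subgroup L & rcoset L h `<=` N.
Proof.
move=> nN.
have [|L [sL oL LK LN]] := @van_dantzig H K (fun x => N (x * h))
    (complmap_tdlc phiP).1 KP.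
  by apply: (@mulgr_continuous H h 1); rewrite mul1g.
exists L => // x; rewrite rcosetE => /LN.
by rewrite mulgVK.
Qed.

(** Convergence to [h] of the image of [f] under [phi], tested on the basic
neighbourhoods of [h] only; these suffice by [small_rcoset_nbhs]. *)
Definition is_limit (f : completion S) h :=
  forall L, small_subgroup L -> f (phi @^-1` rcoset L h).

(** The image of [f] clusters at some [h] in a coset of the compact [K].  For
each small [L] it contains a coset of [L], which meets the neighbourhood [L h]
and therefore equals it. *)
Lemma limit_exists f : exists h, is_limit f h.
Proof.
have KK : small_subgroup K by case: KP; split.
have coset L : small_subgroup L -> exists g, f (phi @^-1` rcoset L (phi g)).
  move=> sL; have [g fg] := Defs.cauchy_ex f (S_small sL).
  by exists g; rewrite preim_rcoset.
have [g fg] := coset K KK.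
have Ff := cauchy_is_filter f.
have PF : ProperFilter (fmap phi (cauchy_sets f)).
  by apply: fmap_proper_filter; split=> // /cauchy_neq0 [].
have [h [_ hP]] : rcoset K (phi g) `&` cluster (fmap phi (cauchy_sets f)) !=set0.
  by apply: (compact_rcoset (cosub_compact KP)).
exists h => L sL; have [k fk] := coset L sL.
have [sgL oL _] := sL.
have nL : nbhs h (rcoset L h).
  by apply: open_nbhs_nbhs; split; [exact: open_rcoset|exact: rcoset_id].
have [y [Ly Lh]] := hP _ _ fk nL.
by rewrite (rcoset_eq sgL Lh) -(rcoset_eq sgL Ly).
Qed.

Definition limit f : H := sval (cid (limit_exists f)).

Lemma limitP f : is_limit f (limit f).
Proof. by rewrite /limit; case: cid. Qed.

(** Continuity of [limit], uniqueness of limits and the computation of the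
preimage of [K] are all read off from this equivalence.  Conversely to
[limitP], a coset of [L] in the image of [f] must be the coset of the limit,
since two members of a Cauchy filter meet. *)
Lemma limit_rcoset f L h : small_subgroup L ->
  rcoset L h (limit f) <-> f (phi @^-1` rcoset L h).
Proof.
move=> sL; have [sgL _ _] := sL; have fL := limitP f sL; split=> [Lf|fh].
  by rewrite (rcoset_eq sgL Lf).
have [g [/= gf gh]] := cauchy_neq0 (@filterI _ _ (cauchy_is_filter f) _ _ fL fh).
by rewrite (rcoset_eq sgL gh) -(rcoset_eq sgL gf); exact: rcoset_id.
Qed.

Lemma limit_unique f h : is_limit f h -> limit f = h.
Proof.
move=> fh; apply: (@topgroup_hausdorff H) => A B nA nB.
exists (limit f); split; first exact: nbhs_singleton.
have [L sL LB] := small_rcoset_nbhs nB.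
by apply: LB; apply/limit_rcoset => //; exact: fh.
Qed.

Lemma limit_completion_map : limit \o completion_map S = phi.
Proof.
apply/funext => g; apply: limit_unique => L sL.
by exists (phi @^-1` L); [exact: S_small|rewrite preim_rcoset].
Qed.

Lemma limit_continuous : continuous limit.
Proof.
move=> f N /small_rcoset_nbhs [L sL LN]; apply/completion_nbhsP.
have [sgL oL _] := sL.
have [g E] := open_rcoset_rep (limit f) sgL oL.
exists (phi @^-1` L), g; rewrite -preim_rcoset -E; split.
- exact: S_small.
- exact: limitP.
- by move=> f' f'L; apply: LN; apply/limit_rcoset.
Qed.

Lemma limitM : {morph limit : x y / x * y}.
Proof.
apply: (dense_hom (@dense_completion_map G S) limit_continuous).
move=> _ _ [x _ <-] [y _ <-]; rewrite -completion_mapM.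
have E z : limit (completion_map S z) = phi z by rewrite -[in RHS]limit_completion_map.
by rewrite !E (complmap_hom phiP).
Qed.

End Limit.

(** * Quotient maps with compact kernel *)

Section Quotients.
Variable K : set H.
Hypothesis KP : compact_open_subgroup K.

Lemma limit_quotient : (forall L, small_subgroup K L -> S (phi @^-1` L)) ->
  exists! psi : completion S -> H,
    [/\ quotient_map psi, compact (ker psi) & psi \o completion_map S = phi].
Proof.
move=> S_small; have [sK _ oK] := KP.
have KK : small_subgroup K K by split.
apply: (proper_unique_quotient (psi := limit KP S_small) _ _ _ _ _ sK oK).
- exact: dense_completion_map.
- exact: (complmap_dense phiP).
- exact: limit_completion_map.
- exact: limitM.
- exact: limit_continuous.
suff -> : limit KP S_small @^-1` K = [set f : completion S | f (phi @^-1` K)].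
  exact: (compact_cauchy (S_small K KK)).
apply/funext => f; apply/propext.
by have := limit_rcoset KP S_small f 1 KK; rewrite rcoset1.
Qed.

Lemma extension_quotient :
  (forall V, S V -> exists2 N, open_trace N & phi @^-1` N `<=` V) ->
  S (phi @^-1` K) ->
  exists! psi : H -> completion S,
    [/\ quotient_map psi, compact (ker psi) & psi \o phi = completion_map S].
Proof.
move=> cof SK; have [sK cK oK] := KP; have tK : open_trace K by split.
apply: (proper_unique_quotient (psi := extension cof) _ _ _ _ _
  (subgroup_cauchy SK) (open_cauchy SK)).
- exact: (complmap_dense phiP).
- exact: dense_completion_map.
- exact: extension_phi.
- exact: extensionM.
- exact: extension_continuous.
suff -> : extension cof @^-1` [set f : completion S | f (phi @^-1` K)] = K by [].
by apply/funext => h; apply/propext; exact: extension_preim.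
Qed.

End Quotients.

End DenseHom.

(** * The Belyaev and Schlichting local filters *)

Section Classes.
Variables (G H : topGroupType) (phi : G -> H).
Hypothesis phiP : tdlc_completion_map phi.
Variable K : set H.
Hypothesis KP : compact_open_subgroup K.

Let U := preim_oc phiP KP.

Lemma small_comm_class L : small_subgroup K L ->
  comm_local_filter U (phi @^-1` L).
Proof.
move=> [sL oL LK].
have sV : is_subgroup (phi @^-1` L) by exact: (preim_subgroup phiP).
split=> //.
  apply: open_subgroup_closed => //.
  by apply: open_comp => // x _; exact: (complmap_continuous phiP).
apply: commensurate_sym; apply: commensurate_super => //.
  by move=> x /LK.
apply: (preim_finite_index phiP) => //; exact: compact_open_finite_index.
Qed.

Lemma schlichting_self : schlichting_local_filter U (phi @^-1` K).
Proof.
split; first exact: (comm_class_self U).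
by exists [:: 1] => x /(_ 1); rewrite conjs1; apply; rewrite /= mem_head.
Qed.

(** A finite intersection of conjugates of [phi @^-1` K] is the preimage of the
same intersection of conjugates of [K]; intersecting further with [K] itself
covers the empty family. *)
Lemma schlichting_trace_cofinal V : schlichting_local_filter U V ->
  exists2 N, open_trace phi (schlichting_local_filter U) N & phi @^-1` N `<=` V.
Proof.
move=> [_ [s sV]].
suff [N tN Ns] : exists2 N, open_trace phi (schlichting_local_filter U) N &
    phi @^-1` N `<=` \bigcap_(g in [set` s]) conjs g (phi @^-1` K).
  by exists N => // x /Ns /sV.
have tK : open_trace phi (schlichting_local_filter U) K.
  by case: (KP) => sK _ oK; split=> //; exact: schlichting_self.
elim: s {sV} => [|g s [N tN Ns]]; first by exists K => // x _ g.
exists (conjs (phi g) K `&` N).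
  by apply: open_traceI => //; exact: (open_traceJ phiP).
rewrite preimage_setI (preim_conjs phiP) => x [xg /Ns xs] h /=.
by rewrite in_cons => /orP[/eqP->|/xs].
Qed.

End Classes.

Unset Implicit Arguments.

Theorem theorem1p4 (G H : topGroupType) (phi : G -> H)
    (phi_compl : tdlc_completion_map phi)
    (K : set H) (K_co : compact_open_subgroup K) :
  let U := preim_oc phi_compl K_co in
  (exists! psi1 : belyaev_completion U -> H,
     [/\ quotient_map psi1, compact (ker psi1) &
         psi1 \o belyaev_map U = phi]) /\
  (exists! psi2 : H -> schlichting_completion U,
     [/\ quotient_map psi2, compact (ker psi2) &
         psi2 \o phi = schlichting_map U]).
Proof.
move=> U; split.
  exact: (limit_quotient phi_compl K_co (small_comm_class phi_compl K_co)).
apply: (extension_quotient phi_compl K_co).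
  exact: schlichting_trace_cofinal.
exact: schlichting_self.
Qed.
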